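(* Let $\Phi=(\phi_n)$, $\Psi=(\psi_n)$ be sequences in $\mathcal H$ and let $m=(m_n)$ be a complex scalar sequence such that $(m_n\|\phi_n\|\|\psi_n\|)$ is NBB. Then the following conditions are equivalent: (i) $M_{m,\Phi,\Psi}$ is unconditionally convergent. (ii) $(m_n\|\phi_n\|\psi_n)$ and $(m_n\|\psi_n\|\phi_n)$ are Bessel for $\mathcal H$. (iii) $(|m_n|\,\|\phi_n\|\psi_n)$ and $\left(\frac{\phi_n}{\|\phi_n\|}\right)$ are Bessel for $\mathcal H$.
   Context: $\mathcal H$ is a complex Hilbert space having an orthonormal basis $(e_n)_{n\in\mathbb N}$ indexed by $\mathbb N$; all sequences and sums are indexed by $\mathbb N$. The multiplier is $M_{m,\Phi,\Psi}f=\sum_{n=1}^\infty m_n\langle f,\psi_n\rangle\phi_n$. It is called unconditionally convergent if for every $f\in\mathcal H$ the series $\sum_n m_n\langle f,\psi_n\rangle\phi_n$ converges unconditionally (i.e. it converges for every permutation of its terms). A scalar sequence $(x_n)$ is NBB (norm-bounded below) if $\inf_n|x_n|>0$. A sequence $(\phi_n)$ in $\mathcal H$ is Bessel for $\mathcal H$ if there is $B<\infty$ with $\sum_n|\langle h,\phi_n\rangle|^2\le B\|h\|^2$ for all $h\in\mathcal H$. *)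

(* Defs.v *)
From HB Require Import structures.
From mathcomp Require Import all_boot all_order all_algebra.
From mathcomp Require Import complex.
From mathcomp Require Import all_classical all_reals all_analysis.

Set Implicit Arguments.
Unset Strict Implicit.
Unset Printing Implicit Defensive.

Import Order.TTheory GRing.Theory Num.Theory.
Import numFieldNormedType.Exports.

Local Open Scope classical_set_scope.
Local Open Scope complex_scope.
Local Open Scope ring_scope.

(* The norm of a normed space over [R[i]] takes its values in [R[i]] (they are
   real and nonnegative there); [rnorm] is the same norm as an element of [R].
   It applies to scalars as well, for which it is the modulus. *)
Definition rnorm (R : realType) (V : normedZmodType R[i]) (x : V) : R :=
  complex.Re `|x|.

(* A Hilbert space is a complete normed module over [R[i]] whose norm is
   induced by a positive definite Hermitian form. As forms in [{dot _ for _}]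
   are, the inner product is linear in its first argument and conjugate-linear
   in its second. *)
Definition induces_norm (R : realType) (H : normedModType R[i])
    (dot : {dot H for @Num.conj R[i]}) : Prop :=
  forall x : H, dot x x = `|x| ^+ 2.

Definition lin_span (R : realType) (H : lmodType R[i]) (e : nat -> H) : set H :=
  [set x | exists (N : nat) (c : nat -> R[i]), x = \sum_(n < N) c n *: e n].

Definition orthonormal_basis (R : realType) (H : normedModType R[i])
    (dot : {dot H for @Num.conj R[i]}) (e : nat -> H) : Prop :=
  (forall i j : nat, dot (e i) (e j) = (i == j)%:R) /\
  closure (lin_span e) = [set: H].

Definition NBB (R : realType) (x : nat -> R[i]) : Prop :=
  0 < inf [set rnorm (x n) | n in [set: nat]].

(* The series of squares is computed in the extended reals: it always has a
   value, and the bound includes the fact that this value is finite. *)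
Definition Bessel (R : realType) (H : normedModType R[i])
    (dot : {dot H for @Num.conj R[i]}) (phi : nat -> H) : Prop :=
  exists B : R, forall h : H,
    (\sum_(0 <= n <oo) (rnorm (dot h (phi n)) ^+ 2)%:E
       <= (B * rnorm h ^+ 2)%:E)%E.

Definition unconditionally_convergent (R : realType) (H : normedModType R[i])
    (u : nat -> H) : Prop :=
  forall s : nat -> nat, bijective s -> cvgn (series (u \o s)).

Definition multiplier_term (R : realType) (H : normedModType R[i])
    (dot : {dot H for @Num.conj R[i]}) (m : nat -> R[i]) (phi psi : nat -> H)
    (f : H) : nat -> H :=
  fun n => (m n * dot f (psi n)) *: phi n.

Definition multiplier_unconditionally_convergent (R : realType)
    (H : normedModType R[i]) (dot : {dot H for @Num.conj R[i]})
    (m : nat -> R[i]) (phi psi : nat -> H) : Prop :=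
  forall f : H, unconditionally_convergent (multiplier_term dot m phi psi f).

(* Main.v *)
(* (i) => (ii): unconditional convergence bounds all sums over finite sets of
   indices for each f, so by uniform boundedness the signed partial sums
   sum_(i < n) +-m_i <f, psi_i> phi_i are operators of norm at most some C. In
   a Hilbert space signs can be chosen so that |sum +-u_i|^2 >= sum |u_i|^2,
   which is the Bessel bound for (m_n |phi_n| psi_n); the same argument for
   the adjoints gives the one for (m_n |psi_n| phi_n).
   (ii) => (iii): the lower bound d on |m_n| |phi_n| |psi_n| gives
   |phi_n|^-1 <= d^-1 |m_n| |psi_n|.
   (iii) => (i): the terms are c_n g_n with (c_n) square summable and
   g_n = phi_n / |phi_n| Bessel, and |sum c_i g_i|^2 <= B sum |c_i|^2 makes
   every rearrangement Cauchy. *)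

Require Import Defs.
From HB Require Import structures.
From mathcomp Require Import all_boot all_order all_algebra.
From mathcomp Require Import complex.
From mathcomp Require Import all_classical all_reals all_analysis.
From mathcomp Require Import ring lra zify.
Import Order.TTheory GRing.Theory Num.Theory.
Import numFieldNormedType.Exports.
Local Open Scope complex_scope.
Local Open Scope ring_scope.

(** * Norms as real numbers *)

Section RealNorm.
Context {R : realType} {V : normedZmodType R[i]}.
Implicit Types x y : V.

Lemma rnormE x : `|x| = (rnorm x)%:C.
Proof. by rewrite /rnorm RRe_real// ger0_real. Qed.

Lemma rnorm_ge0 x : 0 <= rnorm x.
Proof. by rewrite -ler0c -rnormE. Qed.

Lemma rnorm_lt x (e : R) : (`|x| < e%:C) = (rnorm x < e).
Proof. by rewrite rnormE ltcR. Qed.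

Lemma rnorm0 : rnorm (0 : V) = 0.
Proof. by rewrite /rnorm normr0. Qed.

Lemma rnormN x : rnorm (- x) = rnorm x.
Proof. by rewrite /rnorm normrN. Qed.

Lemma rnormB x y : rnorm (x - y) = rnorm (y - x).
Proof. by rewrite /rnorm distrC. Qed.

Lemma rnormD x y : rnorm (x + y) <= rnorm x + rnorm y.
Proof. by rewrite -lecR rmorphD /= -!rnormE ler_normD. Qed.

Lemma rnorm_sum (I : Type) (r : seq I) (P : pred I) (u : I -> V) :
  rnorm (\sum_(i <- r | P i) u i) <= \sum_(i <- r | P i) rnorm (u i).
Proof.
elim/big_rec2: _ => [|i a b _ ab]; first by rewrite rnorm0.
by rewrite (le_trans (rnormD _ _))// lerD2l.
Qed.

Lemma rnorm_id x : rnorm (`|x|) = rnorm x.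
Proof. by rewrite /rnorm normr_id. Qed.

End RealNorm.

Section ScalarNorm.
Context {R : realType}.
Implicit Types a b : R[i].

Lemma rnormZ {V : normedModType R[i]} a (x : V) :
  rnorm (a *: x) = rnorm a * rnorm x.
Proof.
by apply: (fmorph_inj (real_complex R)); rewrite rmorphM /= -!rnormE normrZ.
Qed.

Lemma rnormM a b : rnorm (a * b) = rnorm a * rnorm b.
Proof. exact: (@rnormZ R[i]^o). Qed.

Lemma rnormV a : rnorm a^-1 = (rnorm a)^-1.
Proof.
apply: (fmorph_inj (real_complex R)).
by rewrite fmorphV /= -!rnormE normfV.
Qed.

Lemma rnorm_real (r : R) : rnorm (r%:C) = `|r|.
Proof. by rewrite /rnorm normc_def /= expr0n addr0 sqrtr_sqr. Qed.

Lemma rnormJ a : rnorm (Num.conj a) = rnorm a.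
Proof. by rewrite /rnorm norm_conjC. Qed.

End ScalarNorm.

(** * Inner product and the Cauchy-Schwarz inequality *)

Section InnerProduct.
Context {R : realType} {H : normedModType R[i]}.
Context {dot : {dot H for @Num.conj R[i]}} (dot_norm : induces_norm dot).
Implicit Types x y : H.

Lemma dotC x y : dot x y = Num.conj (dot y x).
Proof. by rewrite hermC expr0 mul1r. Qed.

Lemma dotZr (a : R[i]) x y : dot x (a *: y) = Num.conj a * dot x y.
Proof. by rewrite linearZr_LR. Qed.

Lemma rnorm_dotZr (a : R[i]) x y :
  rnorm (dot x (a *: y)) = rnorm a * rnorm (dot x y).
Proof. by rewrite dotZr rnormM rnormJ. Qed.

Lemma dot_rnorm x : dot x x = (rnorm x ^+ 2)%:C.
Proof. by rewrite dot_norm rnormE rmorphXn. Qed.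

Lemma rnorm_sqrD x y :
  rnorm (x + y) ^+ 2 = rnorm x ^+ 2 + rnorm y ^+ 2 + 2 * complex.Re (dot x y).
Proof.
have <- : complex.Re (dot (x + y) (x + y)) = rnorm (x + y) ^+ 2.
  by rewrite dot_rnorm.
rewrite dnormD !dot_rnorm /=; case: (dot x y) => a b /=; lra.
Qed.

Lemma CauchySchwarz_rnorm x y : rnorm (dot x y) <= rnorm x * rnorm y.
Proof.
(* Expansion of |x - s <x, y> y|^2 >= 0 for real [s]; the value s = |y|^-2, used below when [y] is
   nonzero, minimises the right-hand side. *)
have quad (s : R) : 0 <= rnorm x ^+ 2 +
    rnorm (dot x y) ^+ 2 * ((s * rnorm y) ^+ 2 - 2 * s).
  have := sqr_ge0 (rnorm (x + (- s%:C * dot x y) *: y)).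
  rewrite rnorm_sqrD rnormZ rnormM rnormN dotZr.
  have -> : Num.conj (- s%:C * dot x y) * dot x y =
      (- s * rnorm (dot x y) ^+ 2)%:C.
    rewrite [in LHS]rmorphM (rmorphN Num.conj) [X in - X]conjc_real.
    rewrite -mulrA (mulrC (Num.conj _)) -normCK rnormE.
    by rewrite [in RHS]rmorphM rmorphN rmorphXn.
  rewrite rnorm_real /= !exprMn real_normK ?num_real//.
  lra.
have [y0|y0] := eqVneq (rnorm y) 0.
  suff -> : y = 0 by rewrite linear0r !rnorm0 mulr0.
  by apply/eqP; rewrite -normr_eq0 rnormE y0.
have := quad ((rnorm y ^+ 2)^-1).
have -> : ((rnorm y ^+ 2)^-1 * rnorm y) ^+ 2 - 2 * (rnorm y ^+ 2)^-1 =
  - (rnorm y ^+ 2)^-1 by field.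
rewrite mulrN subr_ge0 ler_pdivrMr ?exprn_gt0 ?lt_def ?y0 ?rnorm_ge0//.
by rewrite -exprMn ler_pXn2r // nnegrE ?mulr_ge0 ?rnorm_ge0.
Qed.

End InnerProduct.

(** * Bessel bounds on finite sums *)

Lemma big_subset_uniq_le {R : realType} {I : eqType} (F : I -> R) (r s : seq I) :
  (forall i, 0 <= F i) -> uniq r -> {subset r <= s} ->
  \sum_(i <- r) F i <= \sum_(i <- s) F i.
Proof.
move=> F0; elim: r s => [|x r IH] s /= ; first by rewrite big_nil sumr_ge0.
move=> /andP[xr ur] sub; have xs : x \in s by apply: sub; rewrite mem_head.
rewrite big_cons (perm_big _ (perm_to_rem xs)) big_cons lerD2l IH// => y yr.
have : y \in s by apply: sub; rewrite inE yr orbT.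
rewrite (perm_mem (perm_to_rem xs)) inE => /predU1P[yx|//].
by rewrite -yx yr in xr.
Qed.

Section BesselFinite.
Context {R : realType} {H : normedModType R[i]}.
Context {dot : {dot H for @Num.conj R[i]}}.

(** Duplicate-free lists in any order are allowed because rearranged partial sums run over such
    lists. *)
Lemma Bessel_uniq (phi : nat -> H) : Bessel dot phi ->
  exists2 B : R, 0 < B & forall h (r : seq nat), uniq r ->
    \sum_(i <- r) rnorm (dot h (phi i)) ^+ 2 <= B * rnorm h ^+ 2.
Proof.
(* [B] itself may be zero or negative; a positive constant is wanted for a later division. *)
move=> [B hB]; exists (`|B| + 1); first by rewrite ltr_wpDl.
move=> h r ur; set F := fun i => rnorm (dot h (phi i)) ^+ 2.
pose n := (\max_(i <- r) i).+1.
have F0 i : 0 <= F i by rewrite sqr_ge0.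
apply: (@le_trans _ _ (\sum_(0 <= i < n) F i)).
  apply: big_subset_uniq_le => // i ir.
  by rewrite mem_index_iota/= ltnS; apply: (leq_bigmax_seq (F := fun j => j)).
apply: (@le_trans _ _ (B * rnorm h ^+ 2)).
  rewrite -lee_fin -sumEFin (le_trans _ (hB h))// nneseries_lim_ge// => k _ _.
  by rewrite lee_fin.
rewrite ler_wpM2r ?sqr_ge0// (le_trans (ler_norm _))// lerDl//.
Qed.

Lemma sum_le_Bessel (phi : nat -> H) (B : R) :
  (forall h n, \sum_(0 <= i < n) rnorm (dot h (phi i)) ^+ 2 <= B * rnorm h ^+ 2) ->
  Bessel dot phi.
Proof.
move=> hB; exists B => h; apply: lime_le.
  by apply: is_cvg_nneseries => n _ _; rewrite lee_fin sqr_ge0.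
by apply: nearW => n; rewrite sumEFin lee_fin.
Qed.

Lemma Bessel_dominated (K : R) (phi chi : nat -> H) :
  (forall h n, rnorm (dot h (chi n)) <= K * rnorm (dot h (phi n))) ->
  Bessel dot phi -> Bessel dot chi.
Proof.
move=> dom /Bessel_uniq[B _ hB].
apply: (@sum_le_Bessel _ (K ^+ 2 * B)) => h n.
apply: (@le_trans _ _ (\sum_(0 <= i < n) K ^+ 2 * rnorm (dot h (phi i)) ^+ 2)).
  apply: ler_sum => i _.
  rewrite -exprMn ler_pXn2r ?nnegrE ?rnorm_ge0//.
  by rewrite (le_trans _ (dom h i)) ?rnorm_ge0.
by rewrite -mulr_sumr -mulrA ler_wpM2l ?sqr_ge0// hB ?iota_uniq.
Qed.

End BesselFinite.

(** * Completeness, uniform boundedness and rearrangements *)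

Lemma rnorm_cauchy_cvg {R : realType} {H : completeNormedModType R[i]}
    (y : nat -> H) :
  (forall e : R, 0 < e -> exists n, forall m, (n <= m)%N -> rnorm (y m - y n) < e) ->
  exists l, forall e : R, 0 < e ->
    exists N, forall n, (N <= n)%N -> rnorm (l - y n) < e.
Proof.
move=> hy.
have : cvgn y.
  apply: cauchy_cvg; apply: cauchy_exP => e e0.
  (* Radii of balls in [H] live in [R[i]]; a positive one is the image of some [d : R]. *)
  have /complex_realP[d ed] : e \is Num.real by rewrite gtr0_real.
  rewrite {}ed in e0 *.
  have [n hn] := hy d ltac:(by rewrite -ltcR).
  exists (y n), n => // m /= nm.
  by rewrite -ball_normE /ball_/= distrC rnorm_lt hn.
move=> /cvg_ex[l hl]; exists l => e e0.
have [N _ hN] := (@cvgrPdist_lt _ _ _ _ _ y l).1 hl e%:C ltac:(by rewrite ltcR).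
by exists N => n Nn; rewrite -rnorm_lt hN.
Qed.

(* [Banach_Steinhauss] is stated for real scalars only; nested balls on which
   some [q i] exceeds [n] give a point where the family is unbounded. *)
Lemma uniform_boundedness {R : realType} {H : completeNormedModType R[i]}
    (I : Type) (q : I -> H -> R) (K : I -> R) :
  (forall i x, q i x <= K i * rnorm x) ->
  (forall i x y, q i (x + y) <= q i x + q i y) ->
  (forall i (a : R) x, q i (a%:C *: x) = `|a| * q i x) ->
  (forall x, exists M, forall i, q i x <= M) ->
  exists C, forall i x, q i x <= C * rnorm x.
Proof.
move=> qK qD qZ qbd; apply: contrapT => unb.
have {}unb (C : R) : 0 <= C -> exists i x, rnorm x <= 1 /\ C < q i x.
  move=> C0; apply: contrapT => nex; apply: unb; exists C => i x.
  have [x0|x0] := eqVneq (rnorm x) 0.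
    by rewrite (le_trans (qK i x))// x0 !mulr0.
  have xpos : 0 < rnorm x by rewrite lt_def x0 rnorm_ge0.
  rewrite -ler_pdivrMr// leNgt; apply/negP => Cq; apply: nex.
  exists i, ((rnorm x)^-1%:C *: x); split.
    by rewrite rnormZ rnorm_real ger0_norm ?invr_ge0 ?rnorm_ge0// mulVf.
  by rewrite qZ ger0_norm ?invr_ge0 ?rnorm_ge0// mulrC.
(* From stage [n] and a closed ball, [good] passes to a ball inside it of at most half the radius,
   on all of which one [q i] exceeds [n]. The conditions on the old radius are premises, so that
   every [s] has a successor and [choice] applies. *)
pose good (s : nat * (H * R)) (t : H * R) := 0 < s.2.2 -> s.2.2 <= 1 ->
  [/\ 0 < t.2, t.2 <= s.2.2 / 2,
   (forall z, rnorm (z - t.1) <= t.2 -> rnorm (z - s.2.1) <= s.2.2) &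
   exists i, forall z, rnorm (z - t.1) <= t.2 -> s.1%:R < q i z].
have step s : exists t, good s t.
  case: s => n [y r]; rewrite /good/=.
  have [r0|] := ltrP 0 r; last by move=> ?; exists (y, r) => ?; lra.
  have C0 : 0 <= (n%:R + 1) / (r / 2).
    by rewrite divr_ge0 ?addr_ge0 ?divr_ge0// ltW.
  have [i [x [x1]]] := unb _ C0.
  rewrite ltr_pdivrMr ?divr_gt0// => qx.
  have [y' yy' qy'] : exists2 y', rnorm (y' - y) <= r / 2 & n%:R + 1 < q i y'.
    have rx : rnorm ((r / 2)%:C *: x) <= r / 2.
      by rewrite rnormZ rnorm_real ger0_norm ?ler_piMr ?divr_ge0// ltW.
    have qrx : q i ((r / 2)%:C *: x) = q i x * (r / 2).
      by rewrite qZ ger0_norm ?divr_ge0// 1?ltW// mulrC.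
    (* The points y + (r/2) x and y - (r/2) x differ by r x, where [q i] exceeds 2 (n + 1); by
       subadditivity [q i] exceeds n + 1 at one of them. *)
    have [qp|qp] := ltrP (n%:R + 1) (q i (y + (r / 2)%:C *: x)).
      by exists (y + (r / 2)%:C *: x) => //; rewrite addrC addKr.
    exists (y - (r / 2)%:C *: x); first by rewrite addrC addKr rnormN.
    have qN u : q i (- u) = q i u.
      by rewrite -[- u]scaleN1r -[-1]/(-1%:C) -rmorphN qZ normrN1 mul1r.
    have := qD i (y + (r / 2)%:C *: x) (- (y - (r / 2)%:C *: x)).
    rewrite qN opprB addrC addrA addrNK -mulr2n -scaler_nat.
    have -> : (2 : R[i]) = 2%:C by rewrite rmorph_nat.
    rewrite qZ qrx ger0_norm//; lra.
  (* On the ball of radius [d] about [y'], [q i] drops by at most k d = r/2 < 1, hence stays above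
     [n]; k >= 1 ensures d <= r/2. *)
  pose k := `|K i| + 1; have k1 : 1 <= k by rewrite lerDr.
  pose d := r / 2 / k; have k0 : 0 < k by lra.
  have d0 : 0 < d by rewrite !divr_gt0.
  have dr : d <= r / 2.
    by rewrite ler_pdivrMr// ler_peMr// divr_ge0// ltW.
  exists (y', d) => _ r1; split => //=.
    move=> z zd; rewrite -(subrK y' z) -addrA (le_trans (rnormD _ _))//.
    by rewrite [leRHS]splitr lerD// (le_trans zd).
  exists i => z zd.
  have := qD i z (y' - z); rewrite addrC subrK => h.
  have : q i (y' - z) <= k * d.
    rewrite (le_trans (qK _ _))// rnormB.
    apply: (@le_trans _ _ (k * rnorm (z - y'))).
      by rewrite ler_wpM2r ?rnorm_ge0// (le_trans (ler_norm _))// lerDl.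
    by rewrite ler_wpM2l// ltW.
  rewrite /d mulrC divfK ?gt_eqF//; lra.
have [f hf] := choice step.
pose fix st n : H * R := if n is p.+1 then f (p, st p) else (0, 1).
have st_pos n : 0 < (st n).2 /\ (st n).2 <= 2^-1 ^+ n.
  elim: n => [|n [r0 rn]]; first by rewrite expr0 /=.
  have [|t0 tr _ _] := hf (n, st n) r0.
    by rewrite (le_trans rn)// exprn_ile1 ?invr_ge0// invf_le1// ler1n.
  split => //=; rewrite (le_trans tr)// exprSr ler_wpM2r// invr_ge0//.
have st_good n : good (n, st n) (st n.+1) by exact: hf.
have st_le1 n : (st n).2 <= 1.
  have [_ h] := st_pos n; rewrite (le_trans h)// exprn_ile1 ?invr_ge0//.
  by rewrite invf_le1// ler1n.
have nest n m z : rnorm (z - (st (n + m)%N).1) <= (st (n + m)%N).2 ->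
    rnorm (z - (st n).1) <= (st n).2.
  elim: m => [|m IH]; first by rewrite addn0.
  rewrite addnS => zm; apply: IH.
  by have [_ _ + _] := st_good _ (st_pos (n + m)%N).1 (st_le1 _); apply.
have st_in n m : (n <= m)%N -> rnorm ((st m).1 - (st n).1) <= (st n).2.
  move=> nm; apply: (@nest _ (m - n)%N); rewrite subnKC// subrr rnorm0.
  by rewrite ltW// (st_pos m).1.
have half_small (e : R) : 0 < e -> exists n, (st n).2 < e.
  move=> e0; have : (((2^-1 : R) ^+ n)%R @[n --> \oo] --> (0 : R)%R)%classic.
    by apply: cvg_expr; rewrite ger0_norm ?invr_ge0// invf_lt1// ltr1n.
  move=> /cvgrPdist_lt/(_ _ e0)[n _ /(_ n (leqnn n))] /=.
  rewrite sub0r normrN ger0_norm ?exprn_ge0 ?invr_ge0// => h.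
  by exists n; rewrite (le_lt_trans (st_pos n).2).
have [l hl] : exists l, forall e : R, 0 < e ->
    exists N, forall n, (N <= n)%N -> rnorm (l - (st n).1) < e.
  apply: rnorm_cauchy_cvg => e /half_small[n hn].
  by exists n => m nm; rewrite (le_lt_trans (st_in _ _ nm)).
have lin n : rnorm (l - (st n).1) <= (st n).2.
  apply/ler_addgt0Pr => e e0; have [N hN] := hl _ e0.
  rewrite -(subrK (st (maxn N n)).1 l) -addrA (le_trans (rnormD _ _))//.
  by rewrite [leRHS]addrC lerD ?st_in ?leq_maxr// ltW// hN// leq_maxl.
(* The common point [l] of all the balls contradicts the pointwise bound at a stage beyond [M]. *)
have [M hM] := qbd l.
have [_ _ _ [i hi]] := st_good (Num.truncn M).+1 (st_pos _).1 (st_le1 _).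
have /= := hi l (lin _); apply/negP; rewrite -leNgt.
by rewrite (le_trans (hM i))// ltW// truncnS_gt.
Qed.

(* If subset sums are unbounded, a rearrangement is built by stages: the list
   [L k] of the indices used so far is extended first by a finite set of fresh
   indices whose terms have a sum of norm at least 1, then by the indices that
   were skipped. *)
Lemma unconditionally_convergent_bounded {R : realType}
    {H : normedModType R[i]} (u : nat -> H) :
  unconditionally_convergent u ->
  exists M : R, forall n (P : pred nat), rnorm (\sum_(0 <= i < n | P i) u i) <= M.
Proof.
move=> ucv; apply: contrapT => unb.
have {}unb (M : R) :
    exists n (P : pred nat), M < rnorm (\sum_(0 <= i < n | P i) u i).
  apply: contrapT => nex; apply: unb; exists M => n P.
  by rewrite leNgt; apply/negP => h; apply: nex; exists n, P.
(* Keeping each list a permutation of an initial segment of the naturals makes the limit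
   rearrangement a bijection. *)
pose initial (s : seq nat) := perm_eq s (iota 0 (size s)).
pose good (s : seq nat) (FG : seq nat * seq nat) := initial s ->
  initial (s ++ FG.1 ++ FG.2) /\ 1 <= rnorm (\sum_(i <- FG.1) u i).
have step s : exists FG, good s FG.
  (* The threshold exceeds by 1 anything the indices already in [s] can contribute, so the fresh
     indices selected by [P] have a sum of norm at least 1. *)
  have [n [P hP]] := unb (1 + \sum_(0 <= i < size s) rnorm (u i)).
  have part (k : nat) : rnorm (\sum_(0 <= i < k | P i) u i) <=
      \sum_(0 <= i < k) rnorm (u i).
    rewrite (le_trans (rnorm_sum _ _ _ _))// [leRHS](bigID P)/= lerDl sumr_ge0//.
    by move=> i _; rewrite rnorm_ge0.
  have sn : (size s <= n)%N.
    rewrite leqNgt; apply/negP => ns.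
    have := lt_le_trans hP (part n).
    rewrite (big_cat_nat (leq0n n) (ltnW ns))/=.
    have : 0 <= \sum_(n <= i < size s) rnorm (u i).
      by rewrite sumr_ge0// => i _; rewrite rnorm_ge0.
    lra.
  pose r := iota (size s) (n - size s).
  exists ([seq i <- r | P i], [seq i <- r | ~~ P i]) => /= s0; split.
    have pr : perm_eq (s ++ [seq i <- r | P i] ++ [seq i <- r | ~~ P i]) (s ++ r).
      by rewrite perm_cat2l; exact: (permEl (perm_filterC P r)).
    rewrite /initial (perm_size pr) (perm_trans pr)//.
    rewrite size_cat size_iota iotaD add0n perm_cat2r//.
  rewrite big_filter.
  have := hP; rewrite (big_cat_nat (leq0n (size s)) sn)/=.
  move/lt_le_trans => /(_ _ (rnormD _ _)).
  have := part (size s); rewrite /r /index_iota; lra.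
have [f hf] := choice step.
pose fix L k : seq nat := if k is p.+1 then L p ++ (f (L p)).1 ++ (f (L p)).2 else [::].
have Linit k : initial (L k) by elim: k => [|k /hf[]].
have Lbig k : 1 <= rnorm (\sum_(i <- (f (L k)).1) u i) by have [] := hf _ (Linit k).
have Lsize k : (k <= size (L k))%N.
  elim: k => // k IH; rewrite /= !size_cat.
  have : (0 < size (f (L k)).1)%N.
    case: (f (L k)).1 (Lbig k) => //=; rewrite big_nil rnorm0; lra.
  by lia.
have Lprefix k m : (k <= m)%N -> exists t, L m = L k ++ t.
  elim: m => [|m IH]; first by rewrite leqn0 => /eqP->; exists [::].
  rewrite leq_eqVlt => /predU1P[->|/IH[t Lm]]; first by exists [::]; rewrite cats0.
  by rewrite /= Lm -catA; eexists.
(* [L n.+1] has more than [n] entries, so the default 0 is never read; later lists extend it and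
   agree with it there. *)
pose s n := nth 0%N (L n.+1) n.
have sE k n : (n < size (L k))%N -> s n = nth 0%N (L k) n.
  move=> nk; rewrite /s; have [/Lprefix[t ->]|/ltnW/Lprefix[t ->]] := leqP k n.+1.
    by rewrite nth_cat nk.
  by rewrite nth_cat Lsize.
have Luniq k : uniq (L k) by rewrite (perm_uniq (Linit k)) iota_uniq.
have memL k i : (i \in L k) = (i < size (L k))%N.
  by rewrite (perm_mem (Linit k)) mem_iota.
have s_bij : bijective s.
  exists (fun i => index i (L i.+1)) => [n|i].
    set k := (maxn n (s n)).+1.
    have nk : (n < size (L k))%N by rewrite (leq_trans _ (Lsize _))// ltnS leq_maxl.
    have [t Lk] : exists t, L k = L (s n).+1 ++ t.
      by apply: Lprefix; rewrite ltnS leq_maxr.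
    have snL : s n \in L (s n).+1 by rewrite memL Lsize.
    rewrite -[in RHS](index_uniq 0%N nk (Luniq k)) -sE// Lk.
    by rewrite (index_cat _ (L (s n).+1) t) snL.
  have iL : i \in L i.+1 by rewrite memL Lsize.
  by rewrite (@sE i.+1) ?index_mem// nth_index.
(* The Cauchy criterion with bound 1 fails on the block of positions that stage [k] fills with its
   fresh indices, for [k] large. *)
have /cvg_cauchy/cauchy_seriesP/(_ 1 ltr01) := ucv s s_bij.
move=> [[A B] /= [[a _ Aa] [b _ Bb]] hAB].
pose k := maxn a b; pose m := (size (L k) + size (f (L k)).1)%N.
suff /hAB/= : (A `*` B)%classic (size (L k), m); last first.
  split; [apply: Aa|apply: Bb] => /=.
    by rewrite (leq_trans (leq_maxl a b))// Lsize.
  by rewrite (leq_trans (leq_maxr a b))// (leq_trans (Lsize k))// leq_addr.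
have -> : \sum_(size (L k) <= j < m) u (s j) = \sum_(i <- (f (L k)).1) u i.
  rewrite [RHS](big_nth 0%N) -{1}[size (L k)]add0n big_addn /m addKn.
  apply: eq_big_nat => j /andP[_ jF] /=.
  rewrite (@sE k.+1) /= ?size_cat; last by lia.
  by rewrite nth_cat ltnNge leq_addl/= addnK nth_cat jF.
rewrite rnormE -[1]/(1%:C) ltcR; apply/negP; rewrite -leNgt; exact: Lbig.
Qed.

(** * Signed partial sums, synthesis and convergence of multipliers *)

Section Multipliers.
Context {R : realType} {H : completeNormedModType R[i]}.
Context {dot : {dot H for @Num.conj R[i]}} (dot_norm : induces_norm dot).

(* Each sign is chosen so that the cross term with the previous partial sum is
   nonnegative. *)
Lemma exists_signs (u : nat -> H) n : exists eps : nat -> bool,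
  \sum_(0 <= i < n) rnorm (u i) ^+ 2 <=
  rnorm (\sum_(0 <= i < n) (-1) ^+ eps i *: u i) ^+ 2.
Proof.
elim: n => [|n [eps IH]].
  by exists xpredT; rewrite !big_geq// rnorm0 expr0n.
set S := \sum_(0 <= i < n) _ *: _ in IH.
pose b := complex.Re (dot S (u n)) < 0.
exists (fun i => if i == n then b else eps i).
rewrite !big_nat_recr//= eqxx.
have -> : \sum_(0 <= i < n) (-1) ^+ (if i == n then b else eps i) *: u i = S.
  by apply: eq_big_nat => i /andP[_ /ltn_eqF->].
rewrite (rnorm_sqrD dot_norm).
have -> : rnorm ((-1) ^+ b *: u n) = rnorm (u n).
  by case: b; rewrite ?expr1 ?expr0 ?scaleN1r ?scale1r ?rnormN.
suff : 0 <= complex.Re (dot S ((-1) ^+ b *: u n)) by lra.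
rewrite /b; case: ltrP => [h|h]; last by rewrite expr0 scale1r.
by rewrite expr1 scaleN1r linearNr raddfN/=; lra.
Qed.

Lemma signed_sum (u : nat -> H) (eps : nat -> bool) n :
  \sum_(0 <= i < n) (-1) ^+ eps i *: u i =
  \sum_(0 <= i < n | ~~ eps i) u i - \sum_(0 <= i < n | eps i) u i.
Proof.
rewrite (bigID eps)/= addrC -sumrN; congr (_ + _); apply: eq_bigr => i.
  by move=> /negbTE->; rewrite expr0 scale1r.
by move=> ->; rewrite expr1 scaleN1r.
Qed.

Definition signs_bounded (m : nat -> R[i]) (phi psi : nat -> H) :=
  exists C : R, forall n (eps : nat -> bool) f,
    rnorm (\sum_(0 <= i < n) (-1) ^+ eps i *: multiplier_term dot m phi psi f i)
      <= C * rnorm f.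

Lemma unconditional_signs_bounded (m : nat -> R[i]) (phi psi : nat -> H) :
  multiplier_unconditionally_convergent dot m phi psi ->
  signs_bounded m phi psi.
Proof.
move=> ucv; pose u := multiplier_term dot m phi psi.
pose q (nP : nat * pred nat) f := rnorm (\sum_(0 <= i < nP.1 | nP.2 i) u f i).
have [C hC] : exists C, forall nP f, q nP f <= C * rnorm f.
  (* Each finite sum is bounded separately by Cauchy-Schwarz; uniformity over all [(n, P)] then
     follows from pointwise boundedness. *)
  apply: (@uniform_boundedness _ _ _ q (fun nP => \sum_(0 <= i < nP.1 | nP.2 i)
    (rnorm (m i) * rnorm (psi i) * rnorm (phi i)))).
  - move=> [n P] f; rewrite /q/= (le_trans (rnorm_sum _ _ _ _))// mulr_suml.
    apply: ler_sum => i _; rewrite rnormZ rnormM.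
    rewrite [leRHS]mulrAC ler_wpM2r ?rnorm_ge0// -mulrA ler_wpM2l ?rnorm_ge0//.
    by rewrite mulrC CauchySchwarz_rnorm.
  - move=> [n P] f g; rewrite /q/= (le_trans _ (rnormD _ _))// -big_split/=.
    rewrite le_eqVlt; apply/orP; left; apply/eqP; congr (rnorm _).
    by apply: eq_bigr => i _; rewrite /u /multiplier_term linearDl mulrDr scalerDl.
  - move=> [n P] a f; rewrite /q/=.
    have -> : \sum_(0 <= i < n | P i) u (a%:C *: f) i =
        a%:C *: \sum_(0 <= i < n | P i) u f i.
      rewrite scaler_sumr; apply: eq_bigr => i _.
      by rewrite /u /multiplier_term linearZl_LR/= scalerA mulrCA.
    by rewrite rnormZ rnorm_real.
  - move=> f; have [M hM] := unconditionally_convergent_bounded _ (ucv f).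
    by exists M => -[n P]; exact: hM.
(* A signed sum is the difference of two subset sums, each of norm at most C |f|. *)
exists (C + C) => n eps f; rewrite signed_sum (le_trans (rnormD _ _))// rnormN.
by rewrite mulrDl lerD// (hC (n, _)).
Qed.

(** The [i]-th multiplier term at [h] has norm |<h, m_i |phi_i| psi_i>|, so well-chosen signs turn
    the operator bound [C] into the Bessel bound C^2. *)
Lemma signs_bounded_Bessel (m : nat -> R[i]) (phi psi : nat -> H) :
  signs_bounded m phi psi ->
  Bessel dot (fun n => (m n * `|phi n|) *: psi n).
Proof.
move=> [C hC]; apply: (@sum_le_Bessel _ _ _ _ (C ^+ 2)) => h n.
have [eps heps] := exists_signs (multiplier_term dot m phi psi h) n.
apply: (@le_trans _ _ (\sum_(0 <= i < n)
    rnorm (multiplier_term dot m phi psi h i) ^+ 2)).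
  apply: ler_sum => i _; rewrite rnorm_dotZr rnormZ !rnormM rnorm_id.
  by rewrite mulrAC.
rewrite (le_trans heps)// -exprMn ler_pXn2r ?nnegrE ?rnorm_ge0//.
by rewrite (le_trans (rnorm_ge0 _) (hC n eps h)).
Qed.

(* The signed partial sums for [(conj m, psi, phi)] are the adjoints of those
   for [(m, phi, psi)], so they have the same operator norms. *)
Lemma signs_bounded_adjoint (m : nat -> R[i]) (phi psi : nat -> H) :
  signs_bounded m phi psi -> signs_bounded (fun n => Num.conj (m n)) psi phi.
Proof.
move=> [C hC]; exists C => n eps g.
set v := \sum_(_ <= _ < _) _.
(* With T the signed partial sum operator, v = T* g and w = T v, so |v|^2 = <T v, g> <= C |v| |g|,
   and |v| cancels. *)
pose w := \sum_(0 <= i < n) (-1) ^+ eps i *: multiplier_term dot m phi psi v i.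
have vv : dot v v = dot w g.
  rewrite {2}/v /w linear_sumr linear_sumlz; apply: eq_bigr => i _.
  rewrite /multiplier_term !scalerA/= dotZr linearZl_LR/= !rmorphM rmorph_sign/=.
  by rewrite conjCK [dot (phi i) g]dotC; ring.
have [v0|v0] := eqVneq (rnorm v) 0.
  (* The empty sum in [hC] yields 0 <= C |g|. *)
  by rewrite v0 (le_trans (rnorm_ge0 _) (hC 0%N eps g)).
have vpos : 0 < rnorm v by rewrite lt_def v0 rnorm_ge0.
rewrite -(ler_pM2l vpos) -expr2.
have -> : rnorm v ^+ 2 = rnorm (dot w g).
  by rewrite -vv (dot_rnorm dot_norm) rnorm_real ger0_norm// sqr_ge0.
rewrite (le_trans (CauchySchwarz_rnorm dot_norm _ _))// mulrA ler_wpM2r ?rnorm_ge0//.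
by rewrite mulrC hC.
Qed.

(* With [v] the sum on the left, Cauchy-Schwarz is replaced by AM-GM:
   [B |v|^2 <= sum B |c i| |<v, g i>| <= (B^2 sum |c i|^2 + B |v|^2) / 2]. *)
Lemma Bessel_synthesis (g : nat -> H) (c : nat -> R[i]) (r : seq nat) (B : R) :
  0 < B -> (forall h, \sum_(i <- r) rnorm (dot h (g i)) ^+ 2 <= B * rnorm h ^+ 2) ->
  rnorm (\sum_(i <- r) c i *: g i) ^+ 2 <= B * \sum_(i <- r) rnorm (c i) ^+ 2.
Proof.
move=> B0 hB; set v := \sum_(i <- r) _.
have : rnorm v ^+ 2 <= \sum_(i <- r) rnorm (c i) * rnorm (dot v (g i)).
  rewrite -[X in X <= _](ger0_norm (sqr_ge0 _)) -rnorm_real -(dot_rnorm dot_norm).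
  rewrite {2}/v linear_sumr (le_trans (rnorm_sum _ _ _ _))//.
  by apply: ler_sum => i _; rewrite rnorm_dotZr.
move=> h1; have := hB v.
set X := rnorm v ^+ 2 in h1 *; set S := \sum_(i <- r) rnorm (c i) ^+ 2.
set D := \sum_(i <- r) _ => h2.
have h3 : B * \sum_(i <- r) rnorm (c i) * rnorm (dot v (g i)) <=
    (B ^+ 2 * S + D) / 2.
  rewrite mulr_sumr /S /D mulr_sumr -big_split/= mulr_suml; apply: ler_sum => i _.
  have := sqr_ge0 (B * rnorm (c i) - rnorm (dot v (g i))); nra.
have h4 : B * X <= B * (B * S).
  have : B * X <= (B ^+ 2 * S + D) / 2 by rewrite (le_trans _ h3)// ler_pM2l.
  nra.
by rewrite ler_pM2l in h4.
Qed.

Lemma Bessel_unconditionally_convergent (g : nat -> H) (c : nat -> R[i]) (M : R) :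
  Bessel dot g ->
  (forall r, uniq r -> \sum_(i <- r) rnorm (c i) ^+ 2 <= M) ->
  unconditionally_convergent (fun n => c n *: g n).
Proof.
move=> /Bessel_uniq[B B0 hB] hM s s_bij.
have s_inj : injective s := bij_inj s_bij.
pose a k := rnorm (c (s k)) ^+ 2.
have : cvgn (series a).
  apply: nondecreasing_is_cvgn.
    by apply: nondecreasing_series => i _ _; exact: sqr_ge0.
  exists M => _ [n _ <-].
  rewrite /series/= -(big_map s xpredT (fun i => rnorm (c i) ^+ 2)) hM//.
  by rewrite map_inj_uniq// iota_uniq.
move=> /cvg_cauchy/cauchy_seriesP ha.
apply: cauchy_cvg; apply/cauchy_seriesP => e e0.
have /complex_realP[d ed] : e \is Num.real by rewrite gtr0_real.
rewrite {}ed ltcR in e0 *.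
(* Synthesis bounds the squared norm of a block by [B] times the block of [a], hence the tolerance
   d^2 / B. *)
have := ha (d ^+ 2 / B) ltac:(by rewrite divr_gt0// exprn_gt0).
apply: filterS => -[k l] /=.
rewrite ger0_norm; last by rewrite sumr_ge0// => i _; exact: sqr_ge0.
rewrite ltr_pdivlMr// mulrC => hd.
rewrite rnorm_lt -(@ltr_pXn2r _ 2) ?nnegrE ?rnorm_ge0 ?(ltW e0)//.
apply: le_lt_trans hd.
rewrite /a -(big_map s xpredT (fun i => rnorm (c i) ^+ 2)).
rewrite -(big_map s xpredT (fun i => c i *: g i)).
apply: Bessel_synthesis => // h.
by rewrite hB// map_inj_uniq// iota_uniq.
Qed.

End Multipliers.

(** * The equivalence *)

Lemma NBB_lower_bound {R : realType} (x : nat -> R[i]) :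
  NBB x -> exists2 d : R, 0 < d & forall n, d <= rnorm (x n).
Proof.
move=> x0; exists (inf [set rnorm (x n) | n in [set: nat]]%classic) => // n.
by apply: ge_inf; [exists 0 => _ [k _ <-]; exact: rnorm_ge0 | exists n].
Qed.

Theorem corollary3p7 (R : realType) (H : completeNormedModType R[i])
    (dot : {dot H for @Num.conj R[i]}) (dot_norm : induces_norm dot)
    (e : nat -> H) (e_basis : orthonormal_basis dot e)
    (phi psi : nat -> H) (m : nat -> R[i])
    (m_NBB : NBB (fun n => m n * `|phi n| * `|psi n|)) :
  [<-> multiplier_unconditionally_convergent dot m phi psi;
       Bessel dot (fun n => (m n * `|phi n|) *: psi n) /\
         Bessel dot (fun n => (m n * `|psi n|) *: phi n);
       Bessel dot (fun n => (`|m n| * `|phi n|) *: psi n) /\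
         Bessel dot (fun n => `|phi n|^-1 *: phi n)].
Proof.
have [d d0 hd] := NBB_lower_bound _ m_NBB.
have phi0 n : `|phi n| != 0.
  apply/eqP => z; have := hd n; rewrite z mulr0 mul0r rnorm0; lra.
tfae.
- move=> /(unconditional_signs_bounded dot_norm _ _ _) bd; split.
    exact: (signs_bounded_Bessel dot_norm).
  (* The adjoint yields the family with conj m_n in place of m_n; only moduli enter the Bessel
     condition. *)
  have := signs_bounded_Bessel dot_norm _ _ _ (signs_bounded_adjoint dot_norm _ _ _ bd).
  apply: (@Bessel_dominated _ _ _ 1) => h n.
  by rewrite mul1r !rnorm_dotZr !rnormM rnormJ.
- move=> [B1 B2]; split.
    apply: (@Bessel_dominated _ _ _ 1) B1 => h n.
    by rewrite mul1r !rnorm_dotZr !rnormM rnorm_id.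
  apply: (@Bessel_dominated _ _ _ d^-1) B2 => h n.
  rewrite !rnorm_dotZr mulrA ler_wpM2r ?rnorm_ge0//.
  rewrite rnormV ler_pdivlMl// ler_pdivrMr.
    by rewrite (le_trans (hd n))// !rnormM mulrAC.
  by rewrite lt_def rnorm_ge0 andbT rnorm_id -(inj_eq (@complexI R)) -rnormE.
- move=> [/Bessel_uniq[B _ hB] B2] f.
  (* Here |c_n| = |<f, |m_n| |phi_n| psi_n>|, so the first Bessel family bounds the sums of squares
     of (c_n) by B |f|^2. *)
  pose c n := m n * dot f (psi n) * `|phi n|.
  have -> : multiplier_term dot m phi psi f =
      (fun n => c n *: (`|phi n|^-1 *: phi n)).
    by apply/funext => n; rewrite scalerA mulfK.
  apply: (Bessel_unconditionally_convergent dot_norm _ _ (B * rnorm f ^+ 2)) => //.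
  move=> r ur; rewrite (le_trans _ (hB f r ur))//; apply: ler_sum => i _.
  by rewrite rnorm_dotZr !rnormM !rnorm_id mulrAC.
Qed.
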